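(* Let $M$ be a metrizable topological space, let $f,G\in C^0(M,\mathbb{R})$ with $G\ge 0$, let $Z\subseteq G^{-1}(0)$ be a compact subset on which $f$ is constant with value $\zeta\in\mathbb{R}$, and let $\Gamma$ be a class of $(f,G)$-gradient flow lines. Suppose $0\le E_0<\mathfrak{S}^+_{f,G}(Z)$ and $I=[a,\infty)$ satisfy conditions (A1$_{(E_0,I)}$) and (A2$_{(E_0,I)}$). Then $\mathcal{M}_{(E_0,I)}$, regarded as a subset of $C^0([a,\infty],M)$ by extending each $\gamma$ continuously to $[a,\infty]$, is compact with respect to the compact-open topology on $C^0([a,\infty],M)$.
   Context: A closed interval is an interval that is a closed subset of $\mathbb{R}$ and not a single point: $[a,b]$ with $a<b$, $(-\infty,a]$, $[a,\infty)$, or $\mathbb{R}$. Spectral gap: $\mathfrak{S}^+_{f,G}(Z):=\inf\{\zeta-f(x)\mid x\in G^{-1}(0)\setminus Z,\ f(x)\le\zeta\}\in[0,\infty]$, with $\inf\emptyset=+\infty$. Energy: for $\gamma\in C^0(I,M)$, $E(\gamma):=\int_I G(\gamma(s))\,ds\in[0,\infty]$. A class of $(f,G)$-gradient flow lines is a family $\Gamma=\{\Gamma(I)\}_I$ of sets indexed by the closed intervals $I\subseteq\mathbb{R}$ such that: (1) $\Gamma(I)\subseteq C^0(I,M)$; (2) for closed intervals $J\subseteq I$, restriction $\gamma\mapsto\gamma|_J$ maps $\Gamma(I)$ into $\Gamma(J)$; (3) $\{\gamma(\cdot+s_0)\mid\gamma\in\Gamma(I)\}=\Gamma(I-s_0)$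 for all $I$ and $s_0\in\mathbb{R}$; (4) for every $\gamma\in\Gamma(I)$, $f\circ\gamma\in C^1(I,\mathbb{R})$ and $(f\circ\gamma)'(s)=G(\gamma(s))$ for all $s\in I$. Moduli space: for $E_0\ge0$ and $I=[a,\infty)$, $\mathcal{M}_{(E_0,I)}:=\{\gamma\in\Gamma(I)\mid E(\gamma)\le E_0$ and the limit $\gamma(\infty):=\lim_{s\to\infty}\gamma(s)$ exists and lies in $Z\}$. $C^0_{\mathrm{loc}}(I,M)$ denotes $C^0(I,M)$ with the compact-open topology. A coarse metric on a topological space $X$ is a metric $d:X\times X\to[0,\infty)$ whose induced topology is coarser than (contained in) the given topology. Topological notions without qualification always refer to the given topology. (A1$_{(E_0,I)}$): For every sequence $(\gamma_n)_n\subseteq\Gamma(I)$ with $E(\gamma_n)\le E_0$ for all $n$, there is a subsequence converging in $C^0_{\mathrm{loc}}(I,M)$ to some $\gamma\in\Gamma(I)$. (A2$_{(E_0,I)}$): For every $z\in Z$ there exist an open neighborhood $U\subseteq M$ of $z$ and a coarse metric $d$ on $U$ (with the subspace topology) such that: whenever $(s_n)_n\subseteq I$ tends to infinity and $(\gamma_n)_n\subseteq\mathcal{M}_{(E_0,I)}$ satisfies $\gamma_n(s)\in U$ for all $s_n\le s\le\infty$ and all $n$, then if $(\gamma_n(s_n))_n$ converges to some point in $Z\cap U$, it follows that $d(\gamma_n(s_n),\gamma_n(\infty))\to0$. *)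

(* Defs.v *)
From HB Require Import structures.
From mathcomp Require Import all_boot all_order all_algebra.
From mathcomp Require Import all_classical all_reals all_analysis.
Set Implicit Arguments.
Unset Strict Implicit.
Unset Printing Implicit Defensive.
Import Order.TTheory GRing.Theory Num.Theory.
Import numFieldNormedType.Exports.
Local Open Scope classical_set_scope.
Local Open Scope ring_scope.

(* Conventions. A function on a subset A of a topological space is a function
   on the subtype [set_type A], which carries the subspace topology. The
   topology of [\bar R] makes it the two-point compactification of the line. *)

Section metrics.
Context {R : realType}.

Record is_metric (T : Type) (d : T -> T -> R) : Prop := {
  metric_ge0 : forall x y, 0 <= d x y ;
  metric_eq0 : forall x y, d x y = 0 <-> x = y ;
  metric_symm : forall x y, d x y = d y x ;
  metric_triang : forall x y z, d x z <= d x y + d y z }.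

Definition metric_open (T : Type) (d : T -> T -> R) : set (set T) :=
  [set A | forall x, A x -> exists2 e : R, 0 < e & [set y | d x y < e] `<=` A].

Definition coarse_metric (X : topologicalType) (d : X -> X -> R) : Prop :=
  is_metric d /\ metric_open d `<=` @open X.

End metrics.

Definition metrizable (R : realType) (X : topologicalType) : Prop :=
  exists d : X -> X -> R, is_metric d /\ metric_open d = @open X.

Section intervals.
Context {R : realType}.

Definition closed_interval (I : set R) : Prop :=
  [\/ exists a b : R, a < b /\ I = `[a, b]%classic,
      exists a : R, I = `]-oo, a]%classic,
      exists a : R, I = `[a, +oo[%classic |
      I = setT].

(* I - s0 *)
Definition shift_set (I : set R) (s0 : R) : set R := [set t | I (t + s0)].

Lemma shift_set_mem (I : set R) (s0 : R) (t : shift_set I s0) :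
  set_val t + s0 \in I.
Proof. exact/mem_set/(set_valP t). Qed.

(* gamma(. + s0) *)
Definition shift_fun (I : set R) (s0 : R) (T : Type) (gamma : I -> T) :
    shift_set I s0 -> T :=
  fun t => gamma (exist _ (set_val t + s0) (shift_set_mem t)).

(* The limit is taken within I, hence is one-sided at the endpoints. *)
Definition deriv_on (I : set R) (h : I -> R) (s : I) (l : R) : Prop :=
  (h t - h s) / (set_val t - set_val s) @[t --> s^'] --> l.

Definition C1_on (I : set R) (h : I -> R) : Prop :=
  exists2 h' : I -> R, continuous h' & forall s, deriv_on h s (h' s).

Definition ray (a : R) : set R := `[a, +oo[%classic.

Definition closed_ray (a : R) : set (\bar R) := `[a%:E, +oo%E]%classic.

(* The filter "s tends to infinity in [a, oo)". *)
Definition ray_pinfty (a : R) : set_system (ray a) :=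
  filter_from setT (fun b : R => [set s : ray a | b < set_val s]).

End intervals.

Arguments shift_fun {R I} s0 {T} gamma t.
Arguments ray_pinfty {R} a _.

Section gradient_flow_lines.
Context {R : realType} {M : topologicalType} (f G : M -> R).

(* [Gamma I] is only meaningful for closed intervals I. *)
Record flow_line_class (Gamma : forall I : set R, set (I -> M)) : Prop := {
  flow_continuous : forall I : set R, closed_interval I ->
    Gamma I `<=` [set gamma | continuous gamma] ;
  flow_restrict : forall (J I : set R) (JI : J `<=` I),
    closed_interval J -> closed_interval I ->
    forall gamma, Gamma I gamma -> Gamma J (gamma \o subfun JI) ;
  flow_shift : forall (I : set R) (s0 : R), closed_interval I ->
    [set shift_fun s0 gamma | gamma in Gamma I] = Gamma (shift_set I s0) ;
  flow_gradient : forall I : set R, closed_interval I ->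
    forall gamma, Gamma I gamma ->
    C1_on (f \o gamma) /\
    forall s : I, deriv_on (f \o gamma) s (G (gamma s)) }.

Local Open Scope ereal_scope.

Definition spectral_gap (Z : set M) (zeta : R) : \bar R :=
  ereal_inf [set (zeta - f x)%:E |
             x in (G @^-1` [set 0%R] `\` Z) `&` [set x | (f x <= zeta)%R]].

(* ['valL_0] extends the integrand, a function on the subtype I, to the line;
   only its values on I matter. *)
Definition energy (I : set R) (gamma : I -> M) : \bar R :=
  \int[lebesgue_measure]_(s in I) ('valL_0%R (G \o gamma) s)%:E.

Variables (Z : set M) (Gamma : forall I : set R, set (I -> M)).

Definition moduli (E0 : R) (a : R) : set (ray a -> M) :=
  [set gamma | [/\ Gamma gamma, energy gamma <= E0%:E &
    exists2 z, Z z & gamma @ ray_pinfty a --> z]].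

(* The continuous extensions to [a, oo] of the elements of the moduli space,
   inside the space of all functions on [a, oo]: on continuous functions its
   compact-open topology induces that of C^0([a, oo], M). *)
Definition extended_moduli (E0 : R) (a : R) :
    set {compact-open, closed_ray a -> M} :=
  [set gammabar : closed_ray a -> M | continuous gammabar /\
    exists2 gamma, moduli E0 gamma &
      forall (s : ray a) (t : closed_ray a),
        set_val t = (set_val s)%:E -> gammabar t = gamma s].

Definition A1 (E0 : R) (I : set R) : Prop :=
  forall gamma_ : nat -> I -> M,
    (forall n, Gamma (gamma_ n) /\ energy (gamma_ n) <= E0%:E) ->
    exists phi : nat -> nat, {homo phi : m n / (m < n)%N} /\
    exists2 gamma, Gamma gamma &
      {compact-open, gamma_ (phi n) @[n --> \oo] --> gamma}.

(* [u n] and [v n] are gamma_n(s_n) and gamma_n(oo), as points of U. *)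
Definition A2 (E0 : R) (a : R) : Prop :=
  forall z, Z z ->
  exists U : set M, [/\ open U, U z &
  exists2 d : U -> U -> R, coarse_metric d &
    forall (s_ : nat -> ray a) (gamma_ : nat -> ray a -> M) (u v : nat -> U),
      (set_val (s_ n) @[n --> \oo] --> +oo%R) ->
      (forall n, moduli E0 (gamma_ n)) ->
      (forall n (s : ray a), (set_val (s_ n) <= set_val s)%R ->
        U (gamma_ n s)) ->
      (forall n, set_val (u n) = gamma_ n (s_ n)) ->
      (forall n, gamma_ n @ ray_pinfty a --> set_val (v n)) ->
      (exists2 w, (Z `&` U) w & gamma_ n (s_ n) @[n --> \oo] --> w) ->
      d (u n) (v n) @[n --> \oo] --> 0%R].

End gradient_flow_lines.

Arguments moduli {R M} G Z Gamma E0 a _.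
Arguments extended_moduli {R M} G Z Gamma E0 a _.

(* Main.v *)
Require Import Defs.
From HB Require Import structures.
From mathcomp Require Import all_boot all_order all_algebra.
From mathcomp Require Import all_classical all_reals all_analysis.
From mathcomp Require Import measurable_realfun lra.
Import Order.TTheory GRing.Theory Num.Theory.
Import numFieldNormedType.Exports.
Local Open Scope classical_set_scope.
Local Open Scope ring_scope.

(** The spaces involved are metrizable, so it suffices to find, for every
    sequence of extended curves [g_ n], a subsequence that converges uniformly
    on [a, oo] to an element of the moduli space.

    Let [gamma_ n] be the restriction of [g_ n] to the ray and [z_ n], a point
    of the compact set Z, its value at infinity. After passing to a
    subsequence, [z_ n] tends to some z in Z and, by (A1), [gamma_ n] tends to
    some flow line gamma, locally uniformly. The remaining issue is the
    behaviour near infinity, where (A1) says nothing: one needs that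
    [gamma_ n s] is close to z as soon as n and s are both large
    ([moduli_tail]). This gives at once that gamma tends to z and that the
    convergence is uniform on all of [a, oo].

    Along a flow line f is nondecreasing, with derivative G, and the energy is
    its total increase ([energy_leP]). Hence curves in the moduli space take
    their f-values in [zeta - E0, zeta] ([moduli_value]), a range in which
    the spectral gap leaves no zero of G outside Z ([zero_in_gap]).
    Consequently, if the f-values of a sequence of flow lines become constant
    in the limit, a subsequence converges to a line of zeros of G, that is,
    into Z ([constant_value_limit]). Applied to the translates of gamma, this
    shows that f tends to zeta along gamma ([flow_value_cvg]); since f is
    monotone along each [gamma_ n], f is then near zeta on
    every late piece of [gamma_ n] as well ([late_value]), so that any late
    points of the curves [gamma_ n] subconverge into Z.

    Suppose that [moduli_tail] fails. Fix a ball around z inside the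
    neighbourhood U of (A2). Infinitely many [gamma_ n] are outside this ball
    at arbitrarily late times, and they end at [z_ n], inside it; let t be the
    last time at which [gamma_ n] is on the sphere ([last_exit]). The points
    [gamma_ n t] subconverge to some w in Z on the sphere, and [gamma_ n] stays
    in U after t, so (A2) says that the coarse distance from [gamma_ n t] to
    [z_ n] tends to 0. But these points tend to w and z in the given topology,
    a fortiori for the coarse metric, which forces w = z: a contradiction. *)

Set Implicit Arguments.
Unset Strict Implicit.

(** * Subsequences and sequential compactness *)

(** Choosing the indices one after the other, each beyond the last. *)
Lemma extract_subsequence (P : nat -> nat -> Prop) :
  (forall k m, exists2 n, (m <= n)%N & P k n) ->
  exists2 phi : nat -> nat, {homo phi : m n / (m < n)%N} & forall k, P k (phi k).
Proof.
move=> Pinf.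
have /choice[c cP] : forall km : nat * nat,
    exists n, (km.2 <= n)%N /\ P km.1 n.
  by move=> [k m]; have [n ? ?] := Pinf k m; exists n.
pose phi := fix phi k := if k is j.+1 then c (k, (phi j).+1) else c (0%N, 0%N).
exists phi.
- apply: homo_ltn => [y x z|k]; first exact: ltn_trans.
  by have [] := cP (k.+1, (phi k).+1).
- by case=> [|k]; [have [] := cP (0%N, 0%N)|have [] := cP (k.+1, (phi k).+1)].
Qed.

Lemma subsequence_ge (phi : nat -> nat) :
  {homo phi : m n / (m < n)%N} -> forall n, (n <= phi n)%N.
Proof.
by move=> phiP; elim=> // n ih; exact: leq_ltn_trans ih (phiP _ _ (ltnSn n)).
Qed.

Lemma cvg_nat_ge (phi : nat -> nat) :
  (forall n, (n <= phi n)%N) -> phi n @[n --> \oo] --> \oo.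
Proof.
move=> phin A [N _ NA]; exists N => // n /= Nn.
by apply: NA; exact: leq_trans Nn (phin n).
Qed.

Lemma cvg_pinfty_ge (R : realType) (u : nat -> R) (c : R) :
  (forall k, c + k%:R <= u k) -> u k @[k --> \oo] --> +oo.
Proof.
move=> cu; apply/cvgryPge => b; near=> k; apply: le_trans (cu k).
rewrite -lerBlDl; near: k; exact: nbhs_infty_ger.
Unshelve. all: by end_near. Qed.

Section sequential_compactness.
Context {R : realType} {T : pseudoMetricType R}.
Implicit Types A : set T.

(** A cluster point has terms of arbitrarily large index in each of its balls;
    pick them in balls of radius 1/(k+1). *)
Lemma compact_subsequence A (u : nat -> T) : compact A -> (forall n, A (u n)) ->
  exists2 phi : nat -> nat, {homo phi : m n / (m < n)%N} &
    exists2 x, A x & u (phi n) @[n --> \oo] --> x.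
Proof.
move=> cA Au; have [x [Ax clx]] : A `&` cluster (u @ \oo) !=set0.
  by apply: cA; exists 0%N => // n _; exact: Au.
have [k m|phi phiP near_x] :=
    @extract_subsequence (fun k n => ball x k.+1%:R^-1 (u n)).
  have := clx [set u n | n in [set n | (m <= n)%N]] (ball x k.+1%:R^-1).
  case.
  - by exists m => // n /= mn; exists n.
  - by apply: nbhsx_ballx; rewrite invr_gt0.
  - by move=> _ [[n mn <-] xn]; exists n.
exists phi => //; exists x => //; apply/cvg_ballP => e e0.
near=> n; apply: le_ball (near_x n).
apply/ltW; near: n; exact: (near_infty_natSinv_lt (PosNum e0)).
Unshelve. all: by end_near. Qed.

(** Sequential compactness gives total boundedness: otherwise a greedy choice
    yields a sequence of points at mutual distance at least e. An ultrafilter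
    that contains A then contains balls [ball (u k) (k+1)^-1] with centers in A,
    and converges to the limit of a subsequence of these centers. *)
Lemma sequentially_compact A :
  (forall u : nat -> T, (forall n, A (u n)) ->
    exists2 phi : nat -> nat, {homo phi : m n / (m < n)%N} &
      exists2 x, A x & u (phi n) @[n --> \oo] --> x) ->
  compact A.
Proof.
move=> seqA; rewrite compact_ultra => F FU FA.
have small e : 0 < e -> exists2 x, A x & F (ball x e).
  move=> e0; apply: contrapT => nsmall.
  (* The balls of radius e around finitely many points do not exhaust A, as F
     contains their complements; S n lists the first n points so chosen. *)
  have far (s : seq T) : (forall y, y \in s -> A y) ->
      exists x, A x /\ forall y, y \in s -> ~ ball y e x.
    move=> sA; suff : F (A `&` [set x | forall y, y \in s -> ~ ball y e x]).
      by move=> /filter_ex[x [Ax ?]]; exists x.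
    apply: filterI => //; elim: s sA => [_|y s ih sA]; first exact: filterE.
    have [Fy|] := @in_ultra_setVsetC _ F (ball y e) FU.
      by case: nsmall; exists y => //; apply: sA; rewrite mem_head.
    have := ih (fun z zs => sA z (mem_behead (s := y :: s) zs)).
    apply: filterS2 => x xs xy z; rewrite inE => /predU1P[->//|]; exact: xs.
  have /choice[c cP] : forall s : seq T, exists x,
      (forall y, y \in s -> A y) ->
      A x /\ forall y, y \in s -> ~ ball y e x.
    move=> s; have [sA|?] := pselect (forall y, y \in s -> A y).
      by have [x ?] := far s sA; exists x.
    by have [x _] := filter_ex FA; exists x.
  pose S n := iter n (fun s => c s :: s) [::].
  have SA n y : y \in S n -> A y.
    elim: n y => //= n ih y; rewrite inE => /predU1P[->|/ih//].
    by have [] := cP _ ih.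
  have Smem m n : (m < n)%N -> c (S m) \in S n.
    elim: n => // n ih; rewrite ltnS leq_eqVlt => /predU1P[->|/ih mn].
      by rewrite /= mem_head.
    by rewrite /= inE mn orbT.
  have [n|phi phiP [x _ cx]] := seqA (fun n => c (S n)).
    by have [] := cP _ (SA n).
  have e20 : 0 < e / 2 by rewrite divr_gt0.
  have [N _ Nx] := cvg_ball cx e20.
  have [_ /(_ (c (S (phi N))))] := cP _ (SA (phi N.+1)).
  move=> /(_ (Smem _ _ (phiP _ _ (ltnSn N)))); apply.
  have Nxx m (Nm : (N <= m)%N) : ball x (e / 2) (c (S (phi m))) := Nx m Nm.
  exact: ball_splitr (Nxx N (leqnn N)) (Nxx N.+1 (leqnSn N)).
have /choice[u uP] : forall k : nat, exists x, A x /\ F (ball x k.+1%:R^-1).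
  by move=> k; have [|x ? ?] := small k.+1%:R^-1; [rewrite invr_gt0|exists x].
have [n|phi phiP [x Ax cx]] := seqA u; first by have [] := uP n.
exists x; split=> //; apply/cvg_ballP => e e0.
have e20 : 0 < e / 2 by rewrite divr_gt0.
near \oo => n.
have := (uP (phi n)).2; apply: filterS => y uy.
apply: (@ball_split _ _ (u (phi n))); first by near: n; exact: cvg_ball.
apply: le_ball uy; apply: (@le_trans _ _ n.+1%:R^-1).
  by rewrite lef_pV2 ?posrE// ler_nat ltnS subsequence_ge.
near: n; have := near_infty_natSinv_lt (PosNum e20).
by apply: filterS => n /ltW.
Unshelve. all: by end_near. Qed.

End sequential_compactness.

(** * Metrics *)

Section metrizable.
Local Open Scope relation_scope.
Context {R : realType}.

(** Structure records have no definitional eta; this equation identifies the one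
    rebuilt from the mixins of M with M itself. *)
Lemma topological_eta (M : topologicalType) :
  @Topological.Pack M (@Topological.Class M
    (Topological.choice_hasChoice_mixin (Topological.class M))
    (Topological.eqtype_hasDecEq_mixin (Topological.class M))
    (Topological.filter_selfFiltered_mixin (Topological.class M))
    (Topological.filter_isFiltered_mixin (Topological.class M))
    (Topological.topology_structure_Nbhs_isTopological_mixin
      (Topological.class M))) = M.
Proof. by case: M => X []. Qed.

(** A metric that induces the topology of M enriches the very structure M: no
    change of topology is involved, so a property of topological spaces may be
    proved assuming that M is a [metricType]. *)
Lemma metrizable_metric (M : topologicalType) (P : topologicalType -> Prop) :
  metrizable R M -> (forall X : metricType R, P X) -> P M.
Proof.
move=> [d [md od]] PX.
pose dball x (e : R) := [set y : M | d x y < e].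
have ballC x (e : R) : 0 < e -> dball x e x.
  by rewrite /dball/= (metric_eq0 md x x).2.
have ballS x y (e : R) : dball x e y -> dball y e x.
  by rewrite /dball/= (metric_symm md).
have ballT x y z (e1 e2 : R) :
    dball x e1 y -> dball y e2 z -> dball x (e1 + e2) z.
  move=> xy yz; rewrite /dball/=.
  by rewrite (le_lt_trans (metric_triang md x y z))// ltrD.
have ball_open x e : open (dball x e).
  rewrite -od => y xy; exists (e - d x y); first by rewrite subr_gt0.
  move=> z /= yz; rewrite /dball/=.
    by rewrite (le_lt_trans (metric_triang md x y z))// -ltrBrDl.
pose ent := entourage_ dball.
have ent_filter : Filter ent.
  apply: filter_from_filter; first by exists 1 => /=.
  move=> e1 e2 /= e10 e20; exists (Num.min e1 e2); first by rewrite lt_min e10.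
  by move=> xy /=; rewrite /dball/= lt_min => /andP[].
have ent_refl E : ent E -> diagonal `<=` E.
  by move=> [e e0 eE] [x y] /diagonalP ->; apply: eE; exact: ballC.
have ent_inv E : ent E -> ent E^-1.
  by move=> [e e0 eE]; exists e => // xy xye; apply: eE; exact: ballS.
have ent_split E : ent E -> exists2 E', ent E' & E' \; E' `<=` E.
  move=> [e e0 eE]; exists [set xy | dball xy.1 (e / 2) xy.2].
    by exists (e / 2) => //=; rewrite divr_gt0.
  move=> [x z] [y /= xy yz]; apply: eE => /=.
  by rewrite (splitr e); exact: ballT yz.
have ent_nbhs : nbhs = nbhs_ ent.
  apply/funext => x; apply/seteqP; split=> A.
    rewrite nbhsE => -[B [oB Bx] BA]; move: oB; rewrite -od => /(_ _ Bx)[e e0 eB].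
    exists [set xy | dball xy.1 e xy.2]; first by exists e.
    by move=> y /xsectionP /= xy; exact/BA/eB.
  move=> [E [e /= e0 eE] EA]; rewrite nbhsE; exists (dball x e).
    by split; [exact: ball_open|exact: ballC].
  by move=> y xy; apply/EA/xsectionP/eE.
pose MU : uniformType := HB.pack M (Nbhs_isUniform_mixin.Build M
  ent_filter ent_refl ent_inv ent_split ent_nbhs).
pose MP : pseudoMetricType R := HB.pack (MU : Type) (Uniform.class MU)
  (Uniform_isPseudoMetric.Build R MU ballC ballS ballT erefl).
have dist0 (x y : MP) : d x y = 0 -> x = y by move/(metric_eq0 md x y).
have ballE (x : MP) (e : R) : ball x e = [set y | d x y < e] by [].
pose MM : metricType R := HB.pack (MP : Type) (PseudoMetric.class MP)
  (PseudoMetric_isMetric.Build R MP (metric_ge0 md) dist0 ballE).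
by rewrite -(topological_eta M); exact: (PX MM).
Qed.

End metrizable.

Lemma cvg_set_val (I : Type) (F : set_system I) (X : topologicalType)
    (A : set X) (u : I -> A) (x : A) : Filter F ->
  set_val (u i) @[i --> F] --> set_val x -> u i @[i --> F] --> x.
Proof.
move=> FF ux B [_ [[W oW <-] /= Wx WB]].
have : F [set i | W (set_val (u i))] by apply: ux; exact: open_nbhs_nbhs.
by apply: (@filterS _ F) => i Wi; exact: WB.
Qed.

(** Balls of a coarse metric are open for the given topology. *)
Lemma coarse_metric_cvg (R : realType) (X : topologicalType)
    (d : X -> X -> R) (u : nat -> X) (x : X) : coarse_metric d ->
  u n @[n --> \oo] --> x -> forall e, 0 < e -> \forall n \near \oo, d x (u n) < e.
Proof.
move=> [md sub] ux e e0; apply: (ux [set y | d x y < e]).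
apply: open_nbhs_nbhs; split; last by rewrite /= (metric_eq0 md x x).2.
apply: sub => y /= xy; exists (e - d x y); first by rewrite subr_gt0.
move=> z /= yz; rewrite (le_lt_trans (metric_triang md x y z))//.
by rewrite -ltrBrDl.
Qed.

Lemma mdist_continuous (R : realType) (M : metricType R) (z : M) :
  continuous (mdist z).
Proof.
move=> x; apply/cvgrPdist_lt => e e0; near=> y.
have : mdist x y < e.
  near: y; have := nbhsx_ballx x _ e0; rewrite ballEmdist; exact: filterS.
have := metric_triangle z x y; have := metric_triangle z y x.
by rewrite (metric_sym y x) ltr_norml => *; lra.
Unshelve. all: by end_near. Qed.

(** * The compact-open topology and uniform convergence *)

(** The point u serves to make V a pointed type, through f u. *)
Lemma compact_open_family (U : topologicalType) (V : uniformType)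
    (f : U -> V) (F : set_system (U -> V)) (u : U) :
  continuous f -> Filter F ->
  {compact-open, F --> f} <-> {family compact, F --> f}.
Proof.
pose V' : puniformType := HB.pack V (isPointed.Build V (f u)).
exact: (@compact_open_fam_compactP U V').
Qed.

Lemma compact_open_pointwise (U V : topologicalType) (F : set_system (U -> V))
    (f : U -> V) : Filter F -> {compact-open, F --> f} ->
  forall u, h u @[h --> F] --> f u.
Proof.
move=> FF /compact_open_cvgP Ff u A; rewrite nbhsE => -[B [oB Bfu] BA].
have fuB : f @` [set u] `<=` B by move=> _ [_ -> <-].
have := Ff _ _ (@compact_set1 _ u) oB fuB.
by apply: (@filterS _ F) => g gB; apply/BA/gB; exists u.
Qed.

(** At a continuous function, the compact-open neighborhoods are neighborhoods
    for uniform convergence; hence cluster points for the latter are cluster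
    points for the former. *)
Lemma compact_uniform_compact_open (U : topologicalType) (V : uniformType)
    (A : set (U -> V)) (u : U) : A `<=` [set g | continuous g] ->
  compact (A : set (arrow_uniform_type U V)) ->
  compact (A : set {compact-open, U -> V}).
Proof.
move=> Acont cA F FF FA; have [p [Ap clp]] := cA F FF FA.
exists p; split=> // B C FB pC; apply: clp => //.
rewrite -uniform_nbhsT.
suff : {compact-open, nbhs (p : {uniform U -> V}) --> p} by apply.
apply/(compact_open_family u (Acont _ Ap))/fam_cvgP => K _.
exact: (@uniform_subset_cvg _ _ p setT K (nbhs (p : {uniform U -> V})) _ _ _).
Qed.

Lemma compact_open_ball (R : realType) (U : topologicalType)
    (V : pseudoMetricType R) (f : U -> V) (F : set_system (U -> V)) (K : set U)
    (u : U) : Filter F -> continuous f -> {compact-open, F --> f} -> compact K ->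
  forall e : R, 0 < e -> \forall h \near F, forall x, K x -> ball (f x) e (h x).
Proof.
move=> FF fc /(compact_open_family u fc)/fam_cvgP Ff cK e e0.
apply: (Ff K cK); apply/uniform_nbhs.
exists [set xy | ball xy.1 e xy.2]; split.
  exact: (entourage_ball V (PosNum e0)).
by move=> h hK x Kx; exact: (hK x Kx).
Qed.

(** * Rays and their compactification *)

Section rays.
Context {R : realType}.
Implicit Types a x : R.

Lemma clamp_mem a x : Num.max a x \in ray a.
Proof. by apply/mem_set; rewrite /ray/= in_itv/= andbT le_max lexx. Qed.

(** This retraction of the line onto the ray turns a curve on the subtype into a
    curve on the line, to which real analysis applies. *)
Definition clamp a x : ray a := exist _ (Num.max a x) (clamp_mem a x).

Lemma ray_ge a (s : ray a) : a <= set_val s.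
Proof. by have := set_valP s; rewrite /ray/= in_itv/= andbT. Qed.

Lemma set_val_clamp a x : set_val (clamp a x) = Num.max a x.
Proof. by []. Qed.

Lemma clampE a x : a <= x -> set_val (clamp a x) = x.
Proof. by move=> ax; rewrite set_val_clamp; exact: max_r. Qed.

Lemma set_val_inj (T : Type) (A : set T) : injective (set_val : A -> T).
Proof. by move=> s t; exact: val_inj. Qed.

Lemma clampK a (s : ray a) : clamp a (set_val s) = s.
Proof. by apply: set_val_inj; rewrite clampE// ray_ge. Qed.

Lemma clamp_max a x : clamp a (Num.max a x) = clamp a x.
Proof. by apply: set_val_inj; rewrite !set_val_clamp maxA maxxx. Qed.

Lemma clamp_continuous a : continuous (clamp a).
Proof.
apply: continuous_comp_initial => x.
apply: (@continuous_max R R (fun=> a) (fun y => y)); last exact: cvg_id.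
exact: cst_continuous.
Qed.

(** Away from the endpoint, difference quotients on the ray thus become
    difference quotients on the line. *)
Lemma clamp_dnbhs a x : a < x -> clamp a @ x^' --> (clamp a x)^'.
Proof.
move=> ax; apply: continuous_injective_withinNx => [|y yx].
  exact: clamp_continuous.
have := congr1 set_val yx; rewrite (clampE (ltW ax)) set_val_clamp.
by case: (leP a y) => // _ ax'; move: ax; rewrite ax' ltxx.
Qed.

Lemma ray_pinftyE a : ray_pinfty a = clamp a @ +oo.
Proof.
apply/seteqP; split=> A.
  move=> [b _ bA]; exists (Num.max a b); split; first exact: num_real.
  move=> x; rewrite gt_max => /andP[ax bx]; apply: bA => /=.
  by rewrite clampE// ltW.
move=> [b [_ bA]]; exists b => // s /= bs.
by rewrite -(clampK s); exact: bA.
Qed.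

Global Instance ray_pinfty_filter a : ProperFilter (ray_pinfty a).
Proof. by rewrite ray_pinftyE; exact: fmap_proper_filter. Qed.

(** It is the image of a segment under [clamp]. *)
Lemma compact_ray_le a b : compact [set s : ray a | set_val s <= b].
Proof.
have -> : [set s : ray a | set_val s <= b] = clamp a @` `[a, b].
  apply/seteqP; split=> [s /= sb|_ [x /= + <-]].
    by exists (set_val s); [rewrite in_itv/= sb ray_ge|exact: clampK].
  by rewrite in_itv/= => /andP[ax xb]; rewrite clampE.
apply: continuous_compact; last exact: segment_compact.
exact/continuous_subspaceT/clamp_continuous.
Qed.

End rays.

Section closed_ray.
Context {R : realType}.
Implicit Types a : R.

Lemma ray_end_mem a : +oo%E \in closed_ray a.
Proof. by apply/mem_set; rewrite /closed_ray/= in_itv/= leey. Qed.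

Definition ray_end a : closed_ray a :=
  exist (fun x => x \in closed_ray a) +oo%E (ray_end_mem a).

Lemma ray_point_mem a (s : ray a) : (set_val s)%:E \in closed_ray a.
Proof. by apply/mem_set; rewrite /closed_ray/= in_itv/= lee_fin ray_ge leey. Qed.

Definition ray_point a (s : ray a) : closed_ray a :=
  exist (fun x => x \in closed_ray a) (set_val s)%:E (ray_point_mem s).

Lemma closed_rayP a (t : closed_ray a) :
  t = ray_end a \/ exists s, t = ray_point s.
Proof.
have : (a%:E <= set_val t)%E.
  by have := set_valP t; rewrite /closed_ray/= in_itv/= => /andP[].
case E : (set_val t) => [r| |//].
  rewrite lee_fin => ar; right; exists (clamp a r); apply: set_val_inj.
  by rewrite E -[RHS]/((set_val (clamp a r))%:E) clampE.
by left; apply: set_val_inj.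
Qed.

Lemma ray_point_cvg a : ray_point s @[s --> ray_pinfty a] --> ray_end a.
Proof.
apply: cvg_set_val.
apply: (@cvg_trans _ ((set_val s)%:E @[s --> ray_pinfty a])) => //.
by apply/cvgeryP/cvgryPge => b; exists b => // s /= /ltW.
Qed.

End closed_ray.

(** * Gradient lines on a ray *)

Section gradient_line.
Context {R : realType} {M : topologicalType}.
Variables (f G : M -> R) (a : R) (eta : ray a -> M).
Hypotheses (f_cont : continuous f) (G_cont : continuous G).
Hypotheses (G_ge0 : forall x, 0 <= G x).
Hypothesis eta_cont : continuous eta.
Hypothesis eta_grad : forall s, deriv_on (f \o eta) s (G (eta s)).

Let F x : R := f (eta (clamp a x)).
Let g x : R := G (eta (clamp a x)).

Lemma line_continuous (h : M -> R) :
  continuous h -> continuous (fun x => h (eta (clamp a x))).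
Proof.
move=> hc x; apply: (@continuous_comp _ _ _ (eta \o clamp a) h).
  by apply: continuous_comp; [exact: clamp_continuous|exact: eta_cont].
exact: hc.
Qed.

Lemma line_is_derive x : a < x -> is_derive x 1 F (g x).
Proof.
move=> ax.
have quot : (F y - F x) / (y - x) @[y --> x^'] --> g x.
  have /(cvg_comp _ _ (clamp_dnbhs ax)) := @eta_grad (clamp a x).
  apply: cvg_trans; apply: near_eq_cvg; near=> y.
  rewrite /= !clampE//; first exact: ltW.
  by apply/ltW; near: y; apply: nbhs_dnbhs; exact: lt_nbhsr.
have shift_x : (fun h : R => h *: (1 : R^o) + x) @ 0^' --> x^'.
  have := @continuous_injective_withinNx _ _ (fun h : R => h *: (1 : R^o) + x) 0.
  rewrite scale0r add0r; apply.
    move=> h; apply: cvgD; last exact: cvg_cst.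
    by apply: cvgZr_tmp; exact: cvg_id.
  by move=> h /eqP; rewrite -subr_eq0 addrK /GRing.scale/= mulr1 => /eqP.
have lim_g : h^-1 *: (F (h *: (1 : R^o) + x) - F x) @[h --> 0^'] --> (g x : R^o).
  apply: cvg_trans (cvg_comp _ _ shift_x quot); apply: near_eq_cvg.
  by apply: nearW => h /=; rewrite addrK /GRing.scale/= mulr1 mulrC.
split; first by apply/cvg_ex; exists (g x); exact: lim_g.
exact: cvg_lim lim_g.
Unshelve. all: by end_near. Qed.

Lemma line_nondecreasing : {homo F : x y / x <= y}.
Proof.
suff mono x y : a <= x -> x <= y -> F x <= F y.
  move=> x y xy; rewrite /F -(clamp_max a x) -(clamp_max a y).
  by apply: mono; rewrite ?ge_max !le_max ?lexx ?xy ?orbT.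
move=> ax xy; apply: (@ger0_derive1_le_cc _ F a y) => //.
- move=> z; rewrite in_itv/= => /andP[az _].
  by have [] := line_is_derive az.
- move=> z; rewrite in_itv/= => /andP[az _]; rewrite derive1E.
  by have [_ ->] := line_is_derive az; exact: G_ge0.
- exact/continuous_subspaceT/line_continuous.
- by rewrite in_itv/= ax.
- by rewrite in_itv/= lexx (le_trans ax xy).
Qed.

Lemma energyE :
  energy G eta = (\int[lebesgue_measure]_(x in `[a, +oo[) (g x)%:E)%E.
Proof.
rewrite /energy; apply: eq_integral => x xa; congr EFin.
have := set_mem xa; rewrite /ray/= in_itv/= andbT => ax.
have := congr1 (@^~ (clamp a x)) (valLK 0 (G \o eta)).
by rewrite /sigL/= -/(set_val (clamp a x)) clampE.
Qed.

(** By the fundamental theorem of calculus the energy is the total increase of f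
    along the curve. Stating it through bounds covers curves of infinite energy
    and does not presuppose a limit of f at infinity. *)
Lemma energy_leP (E0 : R) : (energy G eta <= E0%:E)%E <->
  forall x, a <= x -> F x - F a <= E0.
Proof.
have g_cont : continuous g by exact: line_continuous.
have F_cont : continuous F by exact: line_continuous.
have g_ge0 x : 0 <= g x by exact: G_ge0.
have F_der x : a < x -> derivable F x 1.
  by move=> ax; have [] := line_is_derive ax.
have F_der1 x : a < x -> (F^`())%classic x = g x.
  by move=> ax; rewrite derive1E; have [_ ->] := line_is_derive ax.
rewrite energyE; split=> [EE0 x|FE0].
  rewrite le_eqVlt => /predU1P[<-|ax].
    rewrite subrr -lee_fin; apply: le_trans EE0.
    by apply: integral_ge0 => z _; rewrite lee_fin.
  rewrite -lee_fin EFinB -(@continuous_FTC2 _ g F)//.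
  - apply: le_trans EE0; apply: ge0_subset_integral => //=.
    + apply/measurable_EFinP; apply: measurable_funTS.
      exact: continuous_measurable_fun.
    + by move=> z _; rewrite lee_fin.
    + by apply: subset_itvl; rewrite bnd_simp.
  - exact: continuous_subspaceT.
  - split=> [z| |].
    + by rewrite in_itv/= => /andP[az _]; exact: F_der.
    + by apply: cvg_at_right_filter; exact: F_cont.
    + by apply: cvg_at_left_filter; exact: F_cont.
  - by move=> z; rewrite in_itv/= => /andP[az _]; exact: F_der1.
have Fl : F x @[x --> +oo] --> sup (range F).
  apply: nondecreasing_cvgr; first exact: line_nondecreasing.
  exists (F a + E0) => _ [x _ <-]; rewrite /F -(clamp_max a x) -lerBlDl.
  by apply: FE0; rewrite le_max lexx.
rewrite (ge0_continuous_FTC2y _ _ Fl)//.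
- rewrite -EFinB lee_fin lerBlDr.
  apply: sup_le_ub; first by exists (F a), a.
  move=> _ [x _ <-]; rewrite -lerBlDr /F -(clamp_max a x).
  by apply: FE0; rewrite le_max lexx.
- exact: continuous_subspaceT.
- by apply: cvg_at_right_filter; exact: F_cont.
- by move=> z; rewrite in_itv/= andbT; exact: F_der1.
Qed.

End gradient_line.

(** * Flow lines of bounded energy *)

(** t is the supremum of the closed set of times at least x where h is at
    least r. *)
Lemma last_exit (R : realType) (h : R -> R) (r x : R) : continuous h ->
  (\forall y \near +oo, h y < r) -> r <= h x ->
  exists t, [/\ x <= t, h t = r & forall y, t <= y -> h y <= r].
Proof.
move=> h_cont [b [_ hb]] rx.
pose S := [set y | x <= y] `&` h @^-1` [set y | r <= y].
have Sx : S x by split => /=.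
have S_ub : has_ubound S.
  exists b => y [_ /=]; rewrite leNgt => rhy; rewrite leNgt.
  by apply/negP => /hb ?; case/negP: rhy.
have S_closed : closed S.
  apply: closedI; first exact: closed_ge.
  by apply: preimage_closed => //; exact: closed_ge.
have [xt rt] : S (sup S).
  have := closure_sup (ex_intro _ x Sx) S_ub.
  by rewrite -(iffLR (closure_id S) S_closed).
have h_after y : sup S < y -> h y < r.
  move=> ty; rewrite ltNge; apply/negP => rhy.
  have : y <= sup S.
    by apply: ub_le_sup => //; split=> //=; exact/ltW/(le_lt_trans xt).
  by rewrite leNgt ty.
have ht : h (sup S) <= r.
  apply: (@cvgr_to_le _ (sup S)^'+ _ _ h).
    by apply: cvg_at_right_filter; exact: h_cont.
  near=> y; apply/ltW/h_after; near: y; exact: nbhs_right_gt.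
exists (sup S); split=> // [|y]; first by apply/eqP; rewrite eq_le ht.
by rewrite le_eqVlt => /predU1P[<-//|/h_after/ltW].
Unshelve. all: by end_near. Qed.

(** For c nonnegative, [clamp] only supplies the proof that the shifted time is
    on the ray. *)
Definition translate (R : realType) (T : Type) (a : R) (eta : ray a -> T)
  (c : R) : ray a -> T := fun t => eta (clamp a (set_val t + c)).

Section moduli_space.
Context {R : realType} {M : metricType R} (f G : M -> R).
Hypotheses (f_cont : continuous f) (G_cont : continuous G).
Hypothesis G_ge0 : forall x, 0 <= G x.
Variables (Z : set M) (zeta : R).
Hypotheses (Z_compact : compact Z) (fZ : forall x, Z x -> f x = zeta).
Variables (Gamma : forall I : set R, set (I -> M)).
Hypothesis GammaP : flow_line_class f G Gamma.
Variables (E0 a : R).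
Hypothesis E0_ge0 : 0 <= E0.
Hypothesis gap : (E0%:E < spectral_gap f G Z zeta)%E.

Let value (eta : ray a -> M) (x : R) : R := f (eta (clamp a x)).

Lemma closed_interval_ray (b : R) : closed_interval (ray b).
Proof. by apply: Or43; exists b. Qed.

Lemma flow_ray_continuous (eta : ray a -> M) : Gamma eta -> continuous eta.
Proof. exact: (flow_continuous GammaP (closed_interval_ray a)). Qed.

Lemma flow_ray_gradient (eta : ray a -> M) : Gamma eta ->
  forall s, deriv_on (f \o eta) s (G (eta s)).
Proof. by move=> /(flow_gradient GammaP (closed_interval_ray a))[]. Qed.

Lemma flow_value_nondecreasing (eta : ray a -> M) :
  Gamma eta -> {homo value eta : x y / x <= y}.
Proof.
move=> Geta; exact: line_nondecreasing f_cont G_ge0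
  (flow_ray_continuous Geta) (@flow_ray_gradient _ Geta).
Qed.

Lemma flow_energy_leP (eta : ray a -> M) (E1 : R) : Gamma eta ->
  (energy G eta <= E1%:E)%E <->
  forall x, a <= x -> value eta x - value eta a <= E1.
Proof.
move=> Geta; exact: energy_leP f_cont G_cont G_ge0
  (flow_ray_continuous Geta) (@flow_ray_gradient _ Geta) E1.
Qed.

Lemma translate_value (eta : ray a -> M) (c x : R) : 0 <= c -> a <= x ->
  value (translate eta c) x = value eta (x + c).
Proof. by move=> c0 ax; rewrite /value /translate clampE. Qed.

(** Shifting gives a flow line on the larger ray from a - c, which is then
    restricted. *)
Lemma translate_flow (eta : ray a -> M) (c : R) :
  Gamma eta -> 0 <= c -> Gamma (translate eta c).
Proof.
move=> Geta c0.
have shiftE : shift_set (ray a) c = ray (a - c).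
  by apply/seteqP; split=> t; rewrite /shift_set /ray/= !in_itv/= !andbT lerBlDr.
have sub : ray a `<=` shift_set (ray a) c.
  by rewrite shiftE => t; rewrite /ray/= !in_itv/= !andbT; lra.
have closedI : closed_interval (shift_set (ray a) c).
  by rewrite shiftE; exact: closed_interval_ray.
have : Gamma (shift_fun c eta).
  by rewrite -(flow_shift GammaP _ (closed_interval_ray a)); exists eta.
move=> /(flow_restrict GammaP sub (closed_interval_ray a) closedI).
congr Gamma; apply/funext => t; rewrite /translate /shift_fun/=; congr eta.
apply: set_val_inj; rewrite clampE//.
by have := ray_ge t; lra.
Qed.

(** The increase of f from time a + c on is at most its increase from time a. *)
Lemma translate_energy (eta : ray a -> M) (c : R) : Gamma eta -> 0 <= c ->
  (energy G eta <= E0%:E)%E -> (energy G (translate eta c) <= E0%:E)%E.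
Proof.
move=> Geta c0 /(flow_energy_leP _ Geta) etaE.
apply/(flow_energy_leP _ (translate_flow Geta c0)) => x ax.
rewrite !translate_value//.
have := etaE (x + c) (ler_wpDr c0 ax).
have : value eta a <= value eta (a + c).
  by apply: flow_value_nondecreasing => //; rewrite lerDl.
lra.
Qed.

(** Outside Z, such a zero of G would bound the spectral gap by E0. *)
Lemma zero_in_gap x : G x = 0 -> zeta - E0 <= f x <= zeta -> Z x.
Proof.
move=> Gx /andP[fx1 fx2]; apply: contrapT => nZx.
have : (spectral_gap f G Z zeta <= (zeta - f x)%:E)%E.
  by apply: ereal_inf_lbound; exists x.
by move=> /(lt_le_trans gap); rewrite lte_fin; lra.
Qed.

Hypothesis A1P : A1 G Gamma E0 (ray a).

(** A limit given by (A1) is a flow line on which f takes the constant value l.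
    The derivative of f along it, G, vanishes, so the spectral gap places it
    in Z. *)
Lemma constant_value_limit (eta : nat -> ray a -> M) (l : R) :
  (forall k, Gamma (eta k)) -> (forall k, energy G (eta k) <= E0%:E)%E ->
  (forall s, f (eta k s) @[k --> \oo] --> l) -> zeta - E0 <= l <= zeta ->
  exists2 phi : nat -> nat, {homo phi : m n / (m < n)%N} &
  exists2 w, Z w & eta (phi k) (clamp a (a + 1)) @[k --> \oo] --> w.
Proof.
move=> Geta Eeta feta lE.
have [phi [phiP [gamma Ggamma]]] := A1P (fun k => conj (Geta k) (Eeta k)).
move=> /(compact_open_pointwise _) gammaE.
have {}gammaE s : eta (phi k) s @[k --> \oo] --> gamma s by exact: gammaE.
have f_gamma s : f (gamma s) = l.
  have lim1 : f (eta (phi k) s) @[k --> \oo] --> f (gamma s).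
    exact: (cvg_comp (fun k => eta (phi k) s) f (gammaE s) (@f_cont _)).
  have lim2 : f (eta (phi k) s) @[k --> \oo] --> l.
    apply: (cvg_comp phi (fun k => f (eta k s)) _ (feta s)).
    exact/cvg_nat_ge/subsequence_ge.
  exact: cvg_unique lim1 lim2.
exists phi => //; exists (gamma (clamp a (a + 1))) => //.
apply: zero_in_gap; last by rewrite f_gamma.
(* At the endpoint a only one-sided derivatives are available, hence a + 1. *)
have a1 : a < a + 1 by rewrite ltrDl.
have [_ <-] := line_is_derive (flow_ray_gradient Ggamma) a1.
under [X in derive X]eq_fun do rewrite f_gamma.
exact: derive_cst.
Qed.

(** By monotonicity f has a limit l along gamma. The translates of gamma by k
    have f-values tending to l, so they subconverge into Z and l = zeta. *)
Lemma flow_value_cvg (gamma : ray a -> M) : Gamma gamma ->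
  (energy G gamma <= E0%:E)%E -> (forall s, zeta - E0 <= f (gamma s) <= zeta) ->
  value gamma x @[x --> +oo] --> zeta.
Proof.

move=> Ggamma Egamma fgamma.
pose l := sup (range (value gamma)).
have value_ub : has_ubound (range (value gamma)).
  by exists zeta => _ [x _ <-]; have /andP[] := fgamma (clamp a x).
have /cvg_pinftyP lim_l : value gamma x @[x --> +oo] --> l.
  by apply: nondecreasing_cvgr; first exact: flow_value_nondecreasing.
have l_range : zeta - E0 <= l <= zeta.
  apply/andP; split.
    apply: (@le_trans _ _ (value gamma a)).
      by have /andP[] := fgamma (clamp a a).
    by apply: sup_ubound => //; exists a.
  apply: sup_le_ub; first by exists (value gamma a), a.
  by move=> _ [x _ <-]; have /andP[] := fgamma (clamp a x).
have k0 k : (0 : R) <= k%:R by exact: ler0n.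
have [||s||phi phiP [w Zw cw]] :=
  @constant_value_limit (fun k => translate gamma k%:R) l.
- by move=> k; exact: translate_flow.
- by move=> k; exact: translate_energy.
- by apply: lim_l; apply: (@cvg_pinfty_ge _ _ (set_val s)) => k.
- exact: l_range.
have lim_w : f (translate gamma (phi k)%:R (clamp a (a + 1))) @[k --> \oo]
  --> f w by exact: (cvg_comp _ f cw (@f_cont _)).
suff <- : l = zeta by exact/cvg_pinftyP.
rewrite -(fZ Zw); apply: cvg_unique lim_w => //=.
apply: (lim_l (fun k => set_val (clamp a (a + 1)) + (phi k)%:R)).
apply: (@cvg_pinfty_ge _ _ a) => k.
rewrite clampE ?lerDl// -addrA lerD2l ler_wpDl// ler_nat.
exact: subsequence_ge.
Qed.

(** * Limits of curves in the moduli space *)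

(** f increases to its value zeta at the limit in Z, by at most the energy. *)
Lemma moduli_value (gamma : ray a -> M) : moduli G Z Gamma E0 a gamma ->
  forall s, zeta - E0 <= f (gamma s) <= zeta.
Proof.
move=> [Ggamma Egamma [z Zz gz]].
have lim_zeta : value gamma x @[x --> +oo] --> zeta.
  rewrite -(fZ Zz); apply: (cvg_comp (fun x => gamma (clamp a x)) f
    _ (@f_cont _)).
  by move: gz; rewrite ray_pinftyE.
have le_zeta x : value gamma x <= zeta.
  apply: cvgr_to_ge lim_zeta _; near=> y.
  apply: (flow_value_nondecreasing Ggamma).
  by near: y; apply: nbhs_pinfty_ge; exact: num_real.
move=> s; rewrite -(clampK s); apply/andP; split; last exact: le_zeta.
apply: (@le_trans _ _ (value gamma a)); last first.
  by apply: flow_value_nondecreasing => //; exact: ray_ge.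
rewrite lerBlDr -lerBlDl.
apply: (@cvgr_to_le _ +oo _ _ (fun x => value gamma x - value gamma a)).
  by apply: cvgB lim_zeta _; exact: cvg_cst.
near=> x; apply: (iffLR (flow_energy_leP E0 Ggamma) Egamma).
by near: x; apply: nbhs_pinfty_ge; exact: num_real.
Unshelve. all: by end_near. Qed.

Section limit.
Variables (gamma_ : nat -> ray a -> M) (gamma : ray a -> M).
Hypothesis gamma_moduli : forall n, moduli G Z Gamma E0 a (gamma_ n).
Hypothesis gamma_flow : Gamma gamma.
Hypothesis gamma_lim : forall s, gamma_ n s @[n --> \oo] --> gamma s.

Lemma limit_value s : f (gamma_ n s) @[n --> \oo] --> f (gamma s).
Proof. exact: (cvg_comp (fun n => gamma_ n s) f (@gamma_lim s) (@f_cont _)). Qed.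

Lemma limit_bounds s : zeta - E0 <= f (gamma s) <= zeta.
Proof.
apply/andP; split.
  apply: cvgr_to_ge (@limit_value s) _; apply: nearW => n.
  by have /andP[] := moduli_value (gamma_moduli n) s.
apply: cvgr_to_le (@limit_value s) _; apply: nearW => n.
by have /andP[] := moduli_value (gamma_moduli n) s.
Qed.

Lemma limit_energy : (energy G gamma <= E0%:E)%E.
Proof.
apply/flow_energy_leP => // x ax.
apply: (@cvgr_to_le _ \oo _ _
    (fun n => value (gamma_ n) x - value (gamma_ n) a)).
  by apply: cvgB; exact: limit_value.
apply: nearW => n; have [Gn En _] := gamma_moduli n.
exact: (iffLR (flow_energy_leP E0 Gn) En).
Qed.

(** By monotonicity, f at a late time on [gamma_ n] is at least its value at any
    fixed time T; the latter tends to the value of f at time T on gamma,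
    which is near zeta if T is large. *)
Lemma late_value (c : nat -> R) (n_ : nat -> nat) (s : ray a) :
  (forall k, (k <= n_ k)%N) -> (forall k, 0 <= c k) ->
  c k @[k --> \oo] --> +oo ->
  f (translate (gamma_ (n_ k)) (c k) s) @[k --> \oo] --> zeta.
Proof.
move=> n_ge c0 c_oo; apply/cvgrPdist_le => e e0.
have : \forall x \near +oo, zeta - e < value gamma x.
  have := flow_value_cvg gamma_flow limit_energy limit_bounds.
  by move/cvgr_gt; apply; rewrite ltrBlDr ltrDl.
move=> /filter_ex[T zeta_T].
near=> k.
have /andP[_ fk] := moduli_value (gamma_moduli (n_ k)) (clamp a (set_val s + c k)).
rewrite /translate ler_norml.
suff : zeta - e < f (gamma_ (n_ k) (clamp a (set_val s + c k))) by lra.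
apply: (@lt_le_trans _ _ (value (gamma_ (n_ k)) T)).
  near: k; have := cvg_comp n_ _ (cvg_nat_ge n_ge) (@limit_value (clamp a T)).
  by move/cvgr_gt; apply.
have [Gn _ _] := gamma_moduli (n_ k).
apply: (flow_value_nondecreasing Gn); rewrite -lerBlDl.
near: k; by move/cvgryPge : c_oo; apply.
Unshelve. all: by end_near. Qed.

End limit.

Hypothesis A2P : A2 G Z Gamma E0 a.

Section tail.
Variables (gamma_ : nat -> ray a -> M) (gamma : ray a -> M).
Variables (z_ : nat -> M) (z : M).
Hypothesis gamma_moduli : forall n, moduli G Z Gamma E0 a (gamma_ n).
Hypothesis gamma_flow : Gamma gamma.
Hypothesis gamma_lim : forall s, gamma_ n s @[n --> \oo] --> gamma s.
Hypothesis z_lim : forall n, gamma_ n @ ray_pinfty a --> z_ n.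
Hypotheses (z_z : z_ n @[n --> \oo] --> z) (Zz : Z z).

(** The key step, and the only use of (A2): no curve far in the sequence makes a
    late excursion away from z. An excursion would be followed by a last exit
    from the sphere of radius r around z; the exit points subconverge to a point
    w of Z on that sphere, while (A2) forces w = z. *)
Lemma moduli_tail e : 0 < e -> exists N, exists b,
  forall n s, (N <= n)%N -> b <= set_val s -> mdist z (gamma_ n s) <= e.
Proof.
move=> e0; apply: contrapT => no_tail.
have [U [oU Uz [d d_coarse A2d]]] := A2P Zz.
have [r [r0 re rU]] :
    exists r, [/\ 0 < r, r <= e & forall x, mdist z x <= r -> U x].
  have : nbhs z U by exact: open_nbhs_nbhs.
  rewrite -metricType_numDomainType.filter_from_mdist_nbhs => -[q /= q0 qU].
  exists (Num.min e (q / 2)); split; first by rewrite lt_min e0 divr_gt0.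
  - by rewrite ge_min lexx.
  - by move=> x; rewrite le_min => /andP[_ xq]; apply: qU => /=; lra.
have [N0 _ N0z] : \forall n \near \oo, mdist z (z_ n) < r.
  exact: metricType_numDomainType.cvgr_dist_lt.
(* For each k, a curve of index n at least k, together with the last time t at
   which it is on the sphere of radius r around z. *)
have exits k : exists nt : nat * R, [/\ (k <= nt.1)%N, a + 1 + k%:R <= nt.2,
    mdist z (gamma_ nt.1 (clamp a nt.2)) = r, U (z_ nt.1) &
    forall y, nt.2 <= y -> mdist z (gamma_ nt.1 (clamp a y)) <= r].
  have [n [s [kn ks rs]]] : exists n, exists s : ray a,
      [/\ (maxn k N0 <= n)%N, a + 1 + k%:R <= set_val s & r <= mdist z (gamma_ n s)].
    apply: contrapT => nex; apply: no_tail; exists (maxn k N0), (a + 1 + k%:R).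
    move=> n s kn ks; rewrite leNgt; apply/negP => /ltW es; apply: nex.
    by exists n, s; split=> //; exact: le_trans re es.
  move: kn; rewrite geq_max => /andP[kn N0n].
  have [Gn _ _] := gamma_moduli n.
  have [|||t [st ht t_last]] :=
    @last_exit _ (fun y => mdist z (gamma_ n (clamp a y))) r (set_val s).
  - apply: line_continuous; first exact: flow_ray_continuous.
    exact: mdist_continuous.
  - have := @z_lim n; rewrite ray_pinftyE => zn.
    have /cvgr_lt : mdist z (gamma_ n (clamp a y)) @[y --> +oo] --> mdist z (z_ n).
      exact: (cvg_comp (fun y => gamma_ n (clamp a y)) (mdist z) zn
        (@mdist_continuous _ _ z _)).
    by apply; exact: N0z.
  - by rewrite clampK.
  exists (n, t); split=> //=; first exact: le_trans ks st.
  by apply: rU; exact/ltW/N0z.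
have /choice[nt ntP] := exits.
pose n_ k := (nt k).1; pose t_ k := (nt k).2.
have n_ge k : (k <= n_ k)%N by have [] := ntP k.
have t_ge k : a + 1 + k%:R <= t_ k by have [] := ntP k.
have at_ k : a <= t_ k by have := t_ge k; have := ler0n R k; lra.
(* Translating by c k moves the exit time to a + 1, where the curves are known
   to subconverge into Z. *)
pose c k := t_ k - (a + 1).
have c_ge k : k%:R <= c k by have := t_ge k; rewrite /c; lra.
have c0 k : 0 <= c k by exact: le_trans (c_ge k).
have c_oo : c k @[k --> \oo] --> +oo.
  by apply: (@cvg_pinfty_ge _ _ 0) => k; rewrite add0r.
have [k|k|s||phi phiP [w Zw cw]] :=
  @constant_value_limit (fun k => translate (gamma_ (n_ k)) (c k)) zeta.
- by have [Gn _ _] := gamma_moduli (n_ k); exact: translate_flow.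
- by have [Gn En _] := gamma_moduli (n_ k); exact: translate_energy.
- exact: (late_value gamma_moduli gamma_flow gamma_lim s n_ge c0 c_oo).
- by have := E0_ge0; lra.
have {cw} exit_w : gamma_ (n_ (phi k)) (clamp a (t_ (phi k))) @[k --> \oo] --> w.
  apply: cvg_trans cw; apply: near_eq_cvg; apply: nearW => k.
  by rewrite /translate clampE ?lerDl// /c addrC subrK.
have zw : mdist z w = r.
  have : mdist z (gamma_ (n_ (phi k)) (clamp a (t_ (phi k)))) @[k --> \oo]
      --> mdist z w.
    exact: (cvg_comp _ (mdist z) exit_w (@mdist_continuous _ _ z _)).
  move/(cvg_unique _); apply=> //.
  have -> : (fun k => mdist z (gamma_ (n_ (phi k)) (clamp a (t_ (phi k))))) =
      fun=> r by apply/funext => k; have [] := ntP (phi k).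
  exact: cvg_cst.
have U_tail k y : t_ k <= y -> U (gamma_ (n_ k) (clamp a y)).
  by move=> ty; apply: rU; have [_ _ _ _] := ntP k; apply.
have Uz_ k : U (z_ (n_ k)) by have [] := ntP k.
have Uw : U w by apply: rU; rewrite zw.
pose u k : U := exist (fun x => x \in U) _ (mem_set (U_tail (phi k) _ (lexx _))).
pose v k : U := exist (fun x => x \in U) _ (mem_set (Uz_ (phi k))).
pose w' : U := exist (fun x => x \in U) _ (mem_set Uw).
pose z' : U := exist (fun x => x \in U) _ (mem_set Uz).
have n_phi k : (k <= n_ (phi k))%N.
  exact: leq_trans (subsequence_ge phiP k) (n_ge _).
(* u and v are the exit points and the limits at infinity, as points of U. *)
have duv : d (u k) (v k) @[k --> \oo] --> (0 : R).
  apply: (A2d (fun k => clamp a (t_ (phi k))) (fun k => gamma_ (n_ (phi k)))).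
  - apply: (@cvg_pinfty_ge _ _ (a + 1)) => k; rewrite clampE//.
    apply: le_trans (t_ge (phi k)).
    by rewrite lerD2l ler_nat; exact: subsequence_ge.
  - by move=> k; exact: gamma_moduli.
  - move=> k s; rewrite clampE// => ts; rewrite -(clampK s).
    exact: (U_tail (phi k) _ ts).
  - by [].
  - by move=> k; exact: z_lim.
  - by exists w.
have u_w : u k @[k --> \oo] --> w' by apply: cvg_set_val; exact: exit_w.
have v_z : v k @[k --> \oo] --> z'.
  apply: cvg_set_val; exact: (cvg_comp _ z_ (cvg_nat_ge n_phi) z_z).
have [dm _] := d_coarse.
have : d w' z' = 0.
  apply/eqP; rewrite eq_le (metric_ge0 dm) andbT; apply/ler_addgt0Pr => q q0.
  have q30 : 0 < q / 3 by rewrite divr_gt0.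
  near \oo => k.
  have : d w' (u k) < q / 3 by near: k; exact: coarse_metric_cvg.
  have : d z' (v k) < q / 3 by near: k; exact: coarse_metric_cvg.
  have : d (u k) (v k) < q / 3 by near: k; move/cvgr_lt: duv; apply.
  have := metric_triang dm w' (u k) z'; have := metric_triang dm (u k) (v k) z'.
  by rewrite (metric_symm dm (v k) z'); lra.
move=> /(metric_eq0 dm) /(congr1 set_val) wz.
by move: zw r0; rewrite (_ : w = z)// mdistxx => <-; rewrite ltxx.
Unshelve. all: by end_near. Qed.

End tail.

(** Uniform convergence on [a, oo] is checked separately at infinity, on a
    compact initial piece, and on the tail, where both the curves and their
    limit are close to z. The limit is then continuous as a uniform limit. *)
Lemma extended_moduli_compact : compact (extended_moduli G Z Gamma E0 a).
Proof.
apply: (@compact_uniform_compact_open _ _ _ (ray_end a)) => [g [] //|].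
apply: (@sequentially_compact R (arrow_uniform_type (closed_ray a) M)) => g_ g_ext.
have /choice[gamma_ gammaP] : forall n, exists gamma : ray a -> M,
    moduli G Z Gamma E0 a gamma /\ forall s, g_ n (ray_point s) = gamma s.
  move=> n; have [_ [gamma gamma_moduli gE]] := g_ext n.
  by exists gamma; split=> // s; exact: gE.
have g_cont n : continuous (g_ n) by have [] := g_ext n.
have gamma_moduli n : moduli G Z Gamma E0 a (gamma_ n) by have [] := gammaP n.
have g_point n s : g_ n (ray_point s) = gamma_ n s by have [_] := gammaP n.
pose z_ n := g_ n (ray_end a).
have z_lim n : gamma_ n @ ray_pinfty a --> z_ n.
  have -> : gamma_ n = g_ n \o @ray_point _ a by apply/funext => s /=.
  exact: (cvg_comp _ (g_ n) (@ray_point_cvg _ a) (@g_cont n _)).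
have Zz_ n : Z (z_ n).
  have [_ _ [z' Zz' z'_lim]] := gamma_moduli n.
  by rewrite (cvg_unique _ (@z_lim n) z'_lim)//; exact: metric_hausdorff.
have [psi psiP [z Zz z_z]] := compact_subsequence Z_compact Zz_.
have [|chi [chiP [gamma gamma_flow gamma_co]]] := A1P (gamma_ := gamma_ \o psi).
  by move=> n; have [] := gamma_moduli (psi n).
pose phi := psi \o chi.
have phiP : {homo phi : m n / (m < n)%N} by move=> m n mn; exact/psiP/chiP.
have {gamma_co} gamma_co :
  {compact-open, gamma_ (phi n) @[n --> \oo] --> gamma} := gamma_co.
have z_phi : z_ (phi n) @[n --> \oo] --> z.
  exact: (cvg_comp chi _ (cvg_nat_ge (subsequence_ge chiP)) z_z).
have gamma_lim s : gamma_ (phi n) s @[n --> \oo] --> gamma s.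
  exact: compact_open_pointwise gamma_co s.
have phi_moduli n := gamma_moduli (phi n).
have tail := moduli_tail phi_moduli gamma_flow gamma_lim
  (fun n => z_lim (phi n)) z_phi Zz.
have gamma_tail e : 0 < e -> exists b,
    forall s, b <= set_val s -> mdist z (gamma s) <= e.
  move=> e0; have [N [b Nb]] := tail e e0; exists b => s bs.
  apply: (@cvgr_to_le _ \oo _ _ (fun n => mdist z (gamma_ (phi n) s))).
    exact: (cvg_comp _ (mdist z) (gamma_lim s) (@mdist_continuous _ _ z _)).
  by exists N => // n Nn; exact: Nb.
pose g (t : closed_ray a) := if set_val t is r%:E then gamma (clamp a r) else z.
have gE s : g (ray_point s) = gamma s by rewrite /g/= clampK.
have g_lim : g_ (phi n) @[n --> \oo] -->
    (g : arrow_uniform_type (closed_ray a) M).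
  apply/cvg_ballP => e e0.
  have e30 : 0 < e / 3 by rewrite divr_gt0.
  have [N [b Nb]] := tail _ e30; have [b' b'z] := gamma_tail _ e30.
  pose K := [set s : ray a | set_val s <= Num.max b b'].
  near=> n => t; rewrite ballEmdist /=.
  have [->|[s ->]] := closed_rayP t.
    by near: n; exact: metricType_numDomainType.cvgr_dist_lt.
  rewrite gE g_point; have [sb|] := leP (set_val s) (Num.max b b').
    have : ball (gamma s) e (gamma_ (phi n) s).
      move: s sb; near: n.
      apply: (compact_open_ball (clamp a a)) gamma_co _ _ e0.
        exact: flow_ray_continuous.
      exact: compact_ray_le.
    by rewrite ballEmdist.
  rewrite gt_max => /andP[/ltW bs /ltW b's].
  have : mdist z (gamma_ (phi n) s) <= e / 3.
    by apply: Nb => //; near: n; exists N.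
  have := b'z s b's; have := metric_triangle (gamma s) z (gamma_ (phi n) s).
  by rewrite (metric_sym (gamma s) z); lra.
exists phi => //; exists g => //; split.
  apply: (@uniform_limit_continuous _ _ (g_ (phi n) @[n --> \oo])); last first.
    by rewrite uniform_nbhsT.
  by exists 0%N => // n _ /=; exact: (@g_cont (phi n)).
exists gamma; last by move=> s t; rewrite /g => ->; rewrite clampK.
split=> //; first exact: limit_energy phi_moduli gamma_flow gamma_lim.
exists z => //; apply/metricType_numDomainType.cvgrPdist_le => e e0.
have [b bz] := gamma_tail e e0.
by exists b => // s /= /ltW; exact: bz.
Unshelve. all: by end_near. Qed.

End moduli_space.

Unset Implicit Arguments.

Theorem corollary2 (R : realType) (M : topologicalType) (hM : metrizable R M)
  (f G : M -> R) (hf : continuous f) (hG : continuous G)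
  (hG0 : forall x, 0 <= G x)
  (Z : set M) (hZG : Z `<=` G @^-1` [set 0]) (hZ : compact Z)
  (zeta : R) (hfZ : forall x, Z x -> f x = zeta)
  (Gamma : forall I : set R, set (I -> M)) (hGamma : flow_line_class f G Gamma)
  (E0 a : R) (hE0 : 0 <= E0) (hgap : (E0%:E < spectral_gap f G Z zeta)%E)
  (hA1 : A1 G Gamma E0 (ray a)) (hA2 : A2 G Z Gamma E0 a) :
  compact (extended_moduli G Z Gamma E0 a).

Proof.
move: f G hf hG hG0 Z hZG hZ hfZ Gamma hGamma hgap hA1 hA2.
pattern M; apply: (metrizable_metric hM).
move=> X f G f_cont G_cont G_ge0 Z _ Z_compact fZ Gamma GammaP gap A1P A2P.
exact: (extended_moduli_compact f_cont G_cont G_ge0 Z_compact fZ GammaP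
  hE0 gap A1P A2P).
Qed.
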